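(* Let assumptions A1, A2, A3 (stated in the context) hold, let the data be exact ($\delta_0 = \dots = \delta_{N-1} = 0$), and let $(x_k)$ be generated by the PLWK iteration with truncated step size described in the context. If $\inf_k \theta_k > 0$ and $\sup_k \theta_k < 2$, then $(x_k)$ converges strongly to some $\bar x \in B_\rho(x_0)$ satisfying $F_i(\bar x) = y_i$ for $i = 0,\dots,N-1$.
   Context: $X$ and $Y$ are real Hilbert spaces, $N \ge 1$ is an integer, $F_i : D(F_i) \subset X \to Y$, $i = 0,\dots,N-1$, are (in general nonlinear) operators, and $y_0,\dots,y_{N-1} \in Y$ are exact data. $B_r(x)$ denotes the open ball of radius $r$ centred at $x$ in $X$. Assumption A1: each $F_i$ is continuous on $D(F_i)$; $D := \bigcap_{i} D(F_i)$ has nonempty interior; the initial iterate $x_0 \in D$ is given and there exist constants $C, \rho > 0$ such that $B_\rho(x_0) \subset D$, the Gateaux derivative $F_i'$ is defined on $B_\rho(x_0)$ (with each $F_i'(x): X \to Y$ bounded linear), and $\|F_i'(x)\| \le C$ for all $x \in B_\rho(x_0)$ and $i = 0,\dots,N-1$. Assumption A2 (tangential cone condition): there is a constant $0 \le \eta < 1$ such that $\|F_i(\bar x) - F_i(x) - F_i'(x)(\bar x - x)\| \le \eta\, \|F_i(\bar x) - F_i(x)\|$ for all $x, \bar x \in B_\rho(x_0)$ and $i = 0,\dots,N-1$. Assumption A3: there exists $x^\star \in B_{\rho/2}(x_0)$ with $F_i(x^\star) = y_i$ for $i = 0,\dots,N-1$. PLWK iteration with truncated step size, for exact data: write $[k]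 := k \bmod N \in \{0,\dots,N-1\}$ and fix a constant $\lambda_{\max} > (1-\eta) C^{-2}$. Starting from $x_0$, $$x_{k+1} := x_k - \theta_k \lambda_k \omega_k F_{[k]}'(x_k)^*\big(F_{[k]}(x_k) - y_{[k]}\big),$$ where $\theta_k \in (0,2)$ is a relaxation parameter, $\omega_k := 1$ if $F_{[k]}(x_k) \ne y_{[k]}$ and $\omega_k := 0$ otherwise, and $$\lambda_k := \min\left\{ \frac{(1-\eta)\,\|F_{[k]}(x_k) - y_{[k]}\|^2}{\big\|F_{[k]}'(x_k)^*\big(F_{[k]}(x_k) - y_{[k]}\big)\big\|^2},\ \lambda_{\max} \right\}$$ if $F_{[k]}'(x_k)^*(F_{[k]}(x_k) - y_{[k]}) \ne 0$, and $\lambda_k := 0$ otherwise. (Here $F_i'(x)^*$ is the Hilbert space adjoint. Under A1–A3 all iterates stay in $B_\rho(x_0)$, so the sequence is well defined.) *)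

(* Defs.v *)
From HB Require Import structures.
From mathcomp Require Import all_boot all_order all_algebra sesquilinear.
From mathcomp Require Import all_classical all_reals all_analysis.

Set Implicit Arguments.
Unset Strict Implicit.
Unset Printing Implicit Defensive.
Import Order.TTheory GRing.Theory Num.Theory.
Import numFieldNormedType.Exports.
Local Open Scope classical_set_scope.
Local Open Scope ring_scope.

(* [{dot V for idfun}] is the type of symmetric positive definite bilinear
   forms; as [R] is real, the conjugation is [idfun]. *)
HB.mixin Record CompleteNormedModule_isHilbert (R : realType) V
    & CompleteNormedModule R V := {
  inner : {dot V for (@idfun R)} ;
  inner_norm : forall x : V, inner x x = `|x| ^+ 2
}.

#[short(type="hilbertType")]
HB.structure Definition Hilbert (R : realType) :=
  {V of CompleteNormedModule R V & CompleteNormedModule_isHilbert R V}.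

Section operators.
Context {R : realType} {X Y : normedModType R}.

Definition bounded_linear (L : X -> Y) : Prop :=
  linear L /\ exists M : R, forall v, `|L v| <= M * `|v|.

(* Meaningful for bounded [L] only: [sup] is [0] on unbounded sets. *)
Definition opnorm (L : X -> Y) : R :=
  sup [set `|L v| | v in [set v : X | `|v| <= 1]].

Definition gateaux (f : X -> Y) (x : X) : X -> Y := fun v => 'D_v f x.

Definition gateaux_differentiable (f : X -> Y) (x : X) : Prop :=
  (forall v, derivable f x v) /\ bounded_linear (gateaux f x).

End operators.

(* For bounded linear [L] between Hilbert spaces, the Riesz representation
   theorem gives exactly one such [A]; [get] selects it. *)
Definition adjoint {R : realType} {X Y : hilbertType R} (L : X -> Y) : Y -> X :=
  get [set A : Y -> X | forall v w, inner (L v) w = inner v (A w)].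

Definition cyc {N : nat} (N_gt0 : (0 < N)%N) (k : nat) : 'I_N :=
  Ordinal (ltn_pmod k N_gt0).

Section plwk.
Context {R : realType} {X Y : hilbertType R}.
Implicit Types (f : X -> Y) (y : Y) (x : X).

Definition plwk_direction f y x : X := adjoint (gateaux f x) (f x - y).

Definition plwk_omega f y x : R := if f x != y then 1 else 0.

Definition plwk_lambda (eta lambda_max : R) f y x : R :=
  if plwk_direction f y x != 0 then
    Num.min ((1 - eta) * `|f x - y| ^+ 2 / `|plwk_direction f y x| ^+ 2)
            lambda_max
  else 0.

(* Operators [F i] with domain [D(F_i)] are represented by total functions, so
   this recurrence makes sense for every sequence [x]; in the theorem the values
   of [F i] outside its domain play no role, as the iterates stay in the ball
   contained in all the domains. *)
Definition plwk_sequence (N : nat) (N_gt0 : (0 < N)%N)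
    (F : 'I_N -> X -> Y) (y : 'I_N -> Y) (eta lambda_max : R)
    (theta : nat -> R) (x0 : X) (x : nat -> X) : Prop :=
  x 0%N = x0 /\
  forall k, let i := cyc N_gt0 k in
    x k.+1 = x k - (theta k * plwk_lambda eta lambda_max (F i) (y i) (x k)
                    * plwk_omega (F i) (y i) (x k))
                   *: plwk_direction (F i) (y i) (x k).

End plwk.

(* Main.v *)
Require Import Defs.
From HB Require Import structures.
From mathcomp Require Import all_boot all_order all_algebra sesquilinear.
From mathcomp Require Import all_classical all_reals all_analysis.
From mathcomp Require Import ring lra.
Set Implicit Arguments.
Unset Strict Implicit.
Unset Printing Implicit Defensive.
Import Order.TTheory GRing.Theory Num.Theory.
Import numFieldNormedType.Exports.
Local Open Scope classical_set_scope.
Local Open Scope ring_scope.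

(** Write [a k = `|x k - xs|^2] for the squared distance to a fixed solution
    [xs], and [r k] for the norm of the residual of the equation treated at step
    [k].

    The cone condition makes the update direction [g] satisfy
    [inner (x k - xs) g >= (1 - eta) * r k ^+ 2], and the step size is chosen so
    that the quadratic term of [a k.+1] cannot spoil this gain; hence
    [a k.+1 <= a k - c * r k ^+ 2] with [c > 0] ([plwk_step_descent]). The
    truncation is harmless: since [`|g| <= C * r k], the step sizes stay above
    [(1 - eta) / C ^+ 2]. In particular the iterates never leave the ball.

    Bounded monotonicity gives no strong convergence by itself. The additional
    information is that increments lie in the ranges of adjoint derivatives, so
    that their inner product with an error [x l - xs] is again controlled by
    residuals ([inner_plwk_step_le]). Residuals of all [N] equations at one
    iterate are controlled by the residuals met during the following cycle, hence
    by [S m = sqrt (a m - a (m + N))], the root of the decrease over one cycle.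
    The squares [S m ^+ 2] telescope, with [N] terms in place of one. Comparing
    two iterates [x k] and [x j] with the iterate in between at which [S] is
    smallest bounds [`|x k - x j|^2] by the decrease from [k] to [j] of a
    convergent sequence ([sqr_dist_le]), so [x] is Cauchy. As [S] tends to [0] and
    the [F i] are Lipschitz on the ball by the cone condition, the limit solves
    all the equations.

    The adjoints exist by the Riesz representation theorem ([riesz]), proved here
    by minimising a quadratic functional. *)

(** * Inner product and Riesz representation *)

Section inner_product.
Context {R : realType} {V : hilbertType R}.
Implicit Types (u v w : V) (a : R).

Lemma innerDl u v w : inner (u + v) w = inner u w + inner v w.
Proof. by rewrite linearDl. Qed.

Lemma innerZl a u w : inner (a *: u) w = a * inner u w.
Proof. by rewrite linearZl. Qed.

Lemma innerC u v : inner u v = inner v u.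
Proof. by rewrite hermC/= expr0 mul1r. Qed.

Lemma innerDr w u v : inner w (u + v) = inner w u + inner w v.
Proof. by rewrite innerC innerDl !(innerC w). Qed.

Lemma innerZr a w u : inner w (a *: u) = a * inner w u.
Proof. by rewrite innerC innerZl innerC. Qed.

Lemma innerNl u w : inner (- u) w = - inner u w.
Proof. by rewrite -scaleN1r innerZl mulN1r. Qed.

Lemma inner0l w : inner 0 w = 0.
Proof. by rewrite -(scale0r 0) innerZl mul0r. Qed.

Lemma sqr_normD u v : `|u + v| ^+ 2 = `|u| ^+ 2 + 2 * inner u v + `|v| ^+ 2.
Proof.
by rewrite -!inner_norm innerDl !innerDr (innerC v u) mulrDl mul1r !addrA.
Qed.

Lemma sqr_normB u v : `|u - v| ^+ 2 = `|u| ^+ 2 - 2 * inner u v + `|v| ^+ 2.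
Proof. by rewrite sqr_normD innerC innerNl innerC normrN mulrN. Qed.

(** The norm being given as a norm, the inequality is the triangle inequality
    squared. *)
Lemma inner_le u v : inner u v <= `|u| * `|v|.
Proof.
have : `|u + v| ^+ 2 <= (`|u| + `|v|) ^+ 2.
  by rewrite ler_sqr ?nnegrE ?addr_ge0// ler_normD.
by rewrite sqr_normD; nra.
Qed.

Lemma norm_inner_le u v : `|inner u v| <= `|u| * `|v|.
Proof.
by rewrite ler_norml inner_le andbT lerNl -innerNl -(normrN u) inner_le.
Qed.

End inner_product.

Lemma cvgn_sqr_dist_le (R : realType) (V : completeNormedModType R)
    (x : nat -> V) (eps : nat -> R) :
  eps @ \oo --> (0 : R) ->
  (forall k j, (k <= j)%N -> `|x k - x j| ^+ 2 <= eps k) -> cvgn x.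
Proof.
move=> eps0 dist_le; apply/cauchy_cvgP; apply: cauchy_exP => e e_gt0.
have [k _ /(_ k (leqnn k))/= eps_k] :=
  (@cvgrPdist_lt _ _ _ _ _ _ _).1 eps0 _ (exprn_gt0 2 e_gt0).
exists (x k); exists k => // j /= kj.
rewrite -ball_normE/= -(@ltr_pXn2r _ 2) ?nnegrE ?(ltW e_gt0)//.
apply: (le_lt_trans (dist_le _ _ kj)); apply: le_lt_trans eps_k.
by rewrite sub0r normrN ler_norm.
Qed.

(** The representing vector minimises [v |-> `|v|^2 - 2 phi v]. By the
    parallelogram law a minimising sequence is Cauchy, and at a minimiser the
    first variation vanishes. *)
Lemma riesz (R : realType) (V : hilbertType R) (phi : V -> R) (M : R) :
  (forall u v, phi (u + v) = phi u + phi v) ->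
  (forall a u, phi (a *: u) = a * phi u) ->
  (forall v, `|phi v| <= M * `|v|) ->
  exists a, forall v, phi v = inner v a.
Proof.
move=> phiD phiZ phi_le.
pose J (v : V) := `|v| ^+ 2 - 2 * phi v.
have M_lb v : - M ^+ 2 <= J v.
  rewrite /J; have := phi_le v; have := ler_norm (phi v).
  by have := sqr_ge0 (`|v| - M); nra.
have J_lb : has_lbound (range J) by exists (- M ^+ 2) => _ [v _ <-].
have J_inf : has_inf (range J) by split=> //; exists (J 0), 0.
pose m := inf (range J).
have mJ v : m <= J v by apply: ge_inf => //; exists v.
pose s (n : nat) : R := n.+1%:R^-1.
have s_gt0 n : 0 < s n by rewrite invr_gt0.
have /choice[x xJ] : forall n, exists v, J v < m + s n.
  by move=> n; have [_ [v _ <-] ?] := inf_adherent (s_gt0 n) J_inf; exists v.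
have parallelogram u v : `|u - v| ^+ 2 <= 2 * (J u - m) + 2 * (J v - m).
  have := mJ (2^-1 *: (u + v)).
  rewrite /J normrZ exprMn normfV normr_nat phiZ phiD sqr_normB sqr_normD.
  by rewrite expr2; lra.
have s_dec k j : (k <= j)%N -> s j <= s k.
  by move=> kj; rewrite lef_pV2 ?posrE// ler_nat.
have s_cvg : s @ \oo --> (0 : R) by exact: cvg_harmonic.
have x_cvg : cvgn x.
  apply: (@cvgn_sqr_dist_le _ _ _ (fun k => 4 * s k)) => [|k j kj].
    by rewrite -(mulr0 4); apply: cvgMr.
  apply: (le_trans (parallelogram _ _)).
  by have := xJ k; have := xJ j; have := s_dec _ _ kj; lra.
pose a := limn x.
have phiB u v : phi (u - v) = phi u - phi v.
  by rewrite phiD -scaleN1r phiZ mulN1r.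
have phi_cvg : phi (x n) @[n --> \oo] --> phi a.
  apply/cvgrPdist_lt => e e_gt0.
  have d_gt0 : 0 < e / (`|M| + 1) by rewrite divr_gt0// ltr_wpDl.
  have [k _ xk] := (@cvgrPdist_lt _ _ _ _ _ _ _).1 x_cvg _ d_gt0.
  exists k => // n /xk /=; rewrite ltr_pdivlMr ?ltr_wpDl// -phiB => lt_e.
  apply: le_lt_trans lt_e; apply: (le_trans (phi_le _)).
  by have := ler_norm M; have := normr_ge0 (a - x n); nra.
have J_cvg : J (x n) @[n --> \oo] --> J a.
  apply: cvgB; last by apply: cvgMr.
  by rewrite [X in X @ _ --> _](_ : _ = (fun n => `|x n| * `|x n|)) ?expr2;
    [apply: cvgM; apply: cvg_norm | apply/funext => n; rewrite expr2].
have Ja : J a = m.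
  apply/eqP; rewrite eq_le mJ andbT.
  have ms_cvg : (m + s n) @[n --> \oo] --> m.
    by rewrite -[X in _ --> X]addr0; apply: cvgD => //; exact: cvg_cst.
  rewrite -(cvg_lim _ J_cvg)// -(cvg_lim _ ms_cvg)//.
  apply: ler_lim; [exact: cvgP J_cvg | exact: cvgP ms_cvg |].
  by near=> n; apply: ltW.
exists a => v.
(* [t |-> J (a + t v) - J a] is [2 t (inner a v - phi v) + t^2 `|v|^2]; its
   value at the minimiser of this parabola forces the linear term to vanish. *)
apply/eqP; rewrite eq_sym -subr_eq0; apply/eqP; set d := inner v a - phi v.
have var t : 0 <= 2 * t * d + t ^+ 2 * `|v| ^+ 2.
  have := mJ (a + t *: v); rewrite -Ja /J sqr_normD phiD phiZ normrZ innerZr.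
  by rewrite exprMn real_normK ?num_real// (innerC a) /d; lra.
have := var (- d / (`|v| ^+ 2 + 1)).
have v1 : 0 < `|v| ^+ 2 + 1 by rewrite ltr_wpDl ?sqr_ge0.
rewrite -(pmulr_lge0 _ (exprn_gt0 2 v1)).
have -> : (2 * (- d / (`|v| ^+ 2 + 1)) * d
    + (- d / (`|v| ^+ 2 + 1)) ^+ 2 * `|v| ^+ 2) * (`|v| ^+ 2 + 1) ^+ 2
   = - (d ^+ 2 * (`|v| ^+ 2 + 2)).
  by field; rewrite gt_eqF.
rewrite oppr_ge0 pmulr_lle0; last by rewrite ltr_wpDl ?sqr_ge0.
by rewrite le_eqVlt ltNge sqr_ge0 orbF sqrf_eq0 => /eqP.
Unshelve. all: by end_near. Qed.

(** * Bounded operators and their adjoints *)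

Section bounded_operators.
Context {R : realType}.

Section normed.
Context {X Y : normedModType R}.
Variables (L : X -> Y) (bL : bounded_linear L).

Lemma bounded_linearD u v : L (u + v) = L u + L v.
Proof. by have := bL.1 1 u v; rewrite !scale1r. Qed.

Lemma bounded_linear0 : L 0 = 0.
Proof. by apply: (addrI (L 0)); rewrite -bounded_linearD !addr0. Qed.

Lemma bounded_linearZ a u : L (a *: u) = a *: L u.
Proof. by have := bL.1 a u 0; rewrite bounded_linear0 !addr0. Qed.

Lemma bounded_linearB u v : L (u - v) = L u - L v.
Proof. by rewrite bounded_linearD -scaleN1r bounded_linearZ scaleN1r. Qed.

Lemma le_opnorm v : `|L v| <= opnorm L * `|v|.
Proof.
have [M L_le] := bL.2.
have [->|v0] := eqVneq v 0; first by rewrite bounded_linear0 !normr0 mulr0.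
have nv_gt0 : 0 < `|v| by rewrite normr_gt0.
rewrite -ler_pdivrMr//.
have -> : `|L v| / `|v| = `|L (`|v|^-1 *: v)|.
  by rewrite bounded_linearZ normrZ gtr0_norm ?invr_gt0// mulrC.
apply: ub_le_sup; last first.
  by exists (`|v|^-1 *: v) => //=; rewrite normrZ normfV normr_id mulVf ?gt_eqF.
exists `|M| => _ [w /= w_le1 <-]; apply: (le_trans (L_le w)).
by have := ler_norm M; have := normr_ge0 M; have := normr_ge0 w; nra.
Qed.

End normed.

Lemma adjointP (X Y : hilbertType R) (L : X -> Y) : bounded_linear L ->
  forall v w, inner (L v) w = inner v (adjoint L w).
Proof.
move=> bL; have [M L_le] := bL.2.
suff [A AE] : exists A : Y -> X, forall v w, inner (L v) w = inner v (A w).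
  by rewrite /adjoint; case: xgetP => [_ _|/(_ A)]//; apply.
suff /choice[A AE] : forall w, exists a, forall v, inner (L v) w = inner v a.
  by exists A.
move=> w; apply: (@riesz _ _ _ (M * `|w|)) => [u v|a u|v].
- by rewrite bounded_linearD// innerDl.
- by rewrite bounded_linearZ// innerZl.
- by apply: (le_trans (norm_inner_le _ _)); rewrite mulrAC ler_wpM2r.
Qed.

End bounded_operators.

(** * Consequences of the tangential cone condition *)

(** The tangential cone condition on a set [B], together with the bound [C] on
    the derivative, makes [f] and its linearisation at [z] comparable. *)
Section tangential_cone.
Context {R : realType} {X Y : hilbertType R}.
Variables (f : X -> Y) (B : set X) (C eta : R).
Hypothesis f_diff : forall z, B z -> gateaux_differentiable f z.
Hypothesis df_le : forall z, B z -> opnorm (gateaux f z) <= C.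
Hypotheses (eta_lt1 : eta < 1) (C_gt0 : 0 < C).
Hypothesis tcc : forall z z', B z -> B z' ->
  `|f z' - f z - gateaux f z (z' - z)| <= eta * `|f z' - f z|.

Lemma norm_gateaux_le z v : B z -> `|gateaux f z v| <= C * `|v|.
Proof.
move=> Bz; apply: (le_trans (le_opnorm (f_diff Bz).2 v)).
by rewrite ler_wpM2r// df_le.
Qed.

Lemma tcc_lipschitz z z' : B z -> B z' ->
  `|f z' - f z| <= C / (1 - eta) * `|z' - z|.
Proof.
move=> Bz Bz'; rewrite mulrAC ler_pdivlMr ?subr_gt0//.
have := ler_normD (f z' - f z - gateaux f z (z' - z)) (gateaux f z (z' - z)).
rewrite subrK; have := tcc Bz Bz'; have := norm_gateaux_le (z' - z) Bz; lra.
Qed.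

Lemma tcc_gateaux_le z z' : B z -> B z' ->
  `|gateaux f z (z' - z)| <= 2 * `|f z' - f z|.
Proof.
move=> Bz Bz'.
have := ler_normB (f z' - f z) (f z' - f z - gateaux f z (z' - z)).
rewrite subKr; have := tcc Bz Bz'.
by have := ler_wpM2r (normr_ge0 (f z' - f z)) (ltW eta_lt1); lra.
Qed.

(** * One step of the iteration *)

Section step.
Variables (y : Y) (x : X).
Hypothesis Bx : B x.
Let r := f x - y.
Let g := plwk_direction f y x.

Lemma inner_direction v : inner v g = inner (gateaux f x v) r.
Proof. by rewrite /g /plwk_direction -adjointP//; case: (f_diff Bx). Qed.

Lemma norm_direction_le : `|g| <= C * `|r|.
Proof.
have [->|g0] := eqVneq g 0; first by rewrite normr0 mulr_ge0// ltW.
rewrite -(@ler_pM2l _ `|g|) ?normr_gt0// -expr2 -inner_norm inner_direction.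
apply: (le_trans (inner_le _ _)).
by rewrite mulrA (mulrC `|g|) ler_wpM2r// norm_gateaux_le.
Qed.

Variable lambda_max : R.
Hypothesis lambda_max_gt : (1 - eta) * C ^- 2 < lambda_max.

Lemma lambda_max_ge0 : 0 <= lambda_max.
Proof.
apply/ltW/(le_lt_trans _ lambda_max_gt).
by rewrite mulr_ge0 ?subr_ge0 ?(ltW eta_lt1)// invr_ge0 sqr_ge0.
Qed.

Let mu := plwk_lambda eta lambda_max f y x * plwk_omega f y x.

Lemma stepsize_ge0 : 0 <= mu.
Proof.
rewrite /mu /plwk_lambda /plwk_omega; apply: mulr_ge0; last by case: ifP.
case: ifP => // _; rewrite le_min lambda_max_ge0 andbT.
by rewrite !mulr_ge0 ?invr_ge0 ?sqr_ge0// subr_ge0 ltW.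
Qed.

Lemma stepsize_le : mu <= lambda_max.
Proof.
rewrite /mu /plwk_lambda /plwk_omega.
case: ifP => _; last by rewrite mul0r lambda_max_ge0.
by case: ifP => _; rewrite ?mulr1 ?mulr0 ?lambda_max_ge0// ge_min lexx orbT.
Qed.

Lemma stepsize_direction_le : mu * `|g| ^+ 2 <= (1 - eta) * `|r| ^+ 2.
Proof.
have rhs_ge0 : 0 <= (1 - eta) * `|r| ^+ 2.
  by rewrite mulr_ge0 ?sqr_ge0// subr_ge0 ltW.
rewrite /mu /plwk_lambda /plwk_omega -/g.
case: ifPn => [g0|_]; last by rewrite !mul0r.
case: ifPn => _; last by rewrite mulr0 mul0r.
have g2 : 0 < `|g| ^+ 2 by rewrite exprn_gt0// normr_gt0.
by rewrite mulr1 -ler_pdivlMr// ge_min lexx.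
Qed.

Lemma norm_stepsize_le (theta : R) : 0 < theta < 2 ->
  `|theta * mu| <= 2 * lambda_max.
Proof.
move=> /andP[/ltW theta_ge0 /ltW theta_le2].
have mu_ge0 := stepsize_ge0.
have t_ge0 : 0 <= theta * mu by exact: mulr_ge0.
rewrite ger0_norm//; apply: ler_pM => //; exact: stepsize_le.
Qed.

Lemma norm_plwk_step_le (theta : R) : 0 < theta < 2 ->
  `|(theta * mu) *: g| <= 2 * lambda_max * C * `|r|.
Proof.
move=> theta_itv; rewrite normrZ -mulrA ler_pM ?norm_direction_le//.
exact: norm_stepsize_le.
Qed.

Section solution.
Variable xi : X.
Hypotheses (Bxi : B xi) (f_xi : f xi = y).

(** The negative direction [- g] points towards every solution in [B]. *)
Lemma le_inner_direction : (1 - eta) * `|r| ^+ 2 <= inner (x - xi) g.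
Proof.
have -> : inner (x - xi) g = inner (- gateaux f x (xi - x)) r.
  by rewrite inner_direction !(bounded_linearB (f_diff Bx).2) opprB.
have := tcc Bx Bxi; rewrite f_xi -(opprB (f x)) -/r normrN.
set d := gateaux f x (xi - x) => tcc_r.
have := inner_le (r + d) r; rewrite innerDl inner_norm innerNl.
have : `|r + d| <= eta * `|r| by rewrite -normrN opprD.
by have := normr_ge0 r; nra.
Qed.

Lemma direction_eq0 : g = 0 -> r = 0.
Proof.
move=> g0; have := le_inner_direction; rewrite g0 innerC inner0l.
rewrite pmulr_rle0 ?subr_gt0// => r_le0.
apply/normr0_eq0/eqP; rewrite -sqrf_eq0; apply/eqP/le_anti.
by rewrite r_le0 sqr_ge0.
Qed.

(** The truncation does not let the step sizes degenerate: the quotient in their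
    definition is at least [(1 - eta) / C ^ 2] since [`|g| <= C * `|r|]. *)
Lemma stepsize_residual_ge :
  (1 - eta) * C ^- 2 * `|r| ^+ 2 <= mu * `|r| ^+ 2.
Proof.
have [r0|r0] := eqVneq r 0; first by rewrite r0 normr0 expr0n !mulr0.
have g0 : g != 0 by apply: contra_neq r0; exact: direction_eq0.
have fx_y : f x != y by rewrite -subr_eq0.
rewrite ler_wpM2r ?sqr_ge0// /mu /plwk_lambda /plwk_omega -/g g0 fx_y mulr1.
rewrite le_min (ltW lambda_max_gt) andbT -mulrA.
rewrite ler_wpM2l ?subr_ge0 ?(ltW eta_lt1)//.
rewrite ler_pdivlMr ?exprn_gt0 ?normr_gt0// mulrC ler_pdivrMr ?exprn_gt0//.
rewrite -exprMn mulrC ler_sqr ?nnegrE ?mulr_ge0 ?(ltW C_gt0)//.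
exact: norm_direction_le.
Qed.

(** Expanding the square, the linear term is bounded by [le_inner_direction] and
    the quadratic one by the choice of the step size. *)
Lemma plwk_step_descent (theta : R) : 0 < theta < 2 ->
  `|x - (theta * mu) *: g - xi| ^+ 2 <=
  `|x - xi| ^+ 2 - theta * (2 - theta) * ((1 - eta) ^+ 2 * C ^- 2) * `|r| ^+ 2.
Proof.
move=> /andP[theta_gt0 theta_lt2].
rewrite addrAC (sqr_normB (x - xi)) innerZr normrZ exprMn real_normK ?num_real//.
have mu0 := stepsize_ge0.
have lin := ler_wpM2l mu0 le_inner_direction.
have quad := ler_wpM2l mu0 stepsize_direction_le.
have low : (1 - eta) ^+ 2 * C ^- 2 * `|r| ^+ 2 <= (1 - eta) * (mu * `|r| ^+ 2).
  rewrite expr2 -2!mulrA ler_wpM2l ?subr_ge0 ?(ltW eta_lt1)// mulrA.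
  exact: stepsize_residual_ge.
have lin' := ler_wpM2l (ltW theta_gt0) lin.
have quad' := ler_wpM2l (sqr_ge0 theta) quad.
have tt : 0 <= theta * (2 - theta) by rewrite mulr_ge0 ?subr_ge0 ?ltW.
have low' := ler_wpM2l tt low.
lra.
Qed.

(** The increment is the image of the residual under the adjoint derivative, so
    testing it against [w - xi] only costs the residuals at [x] and [w]. *)
Lemma inner_plwk_step_le (theta : R) w : 0 < theta < 2 -> B w ->
  `|inner ((theta * mu) *: g) (w - xi)| <=
  4 * lambda_max * `|r| * (2 * `|r| + `|f w - y|).
Proof.
move=> theta_itv Bw.
rewrite innerZl innerC inner_direction normrM.
have t_le := norm_stepsize_le theta_itv.
have -> : gateaux f x (w - xi) = gateaux f x (w - x) - gateaux f x (xi - x).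
  by rewrite -(bounded_linearB (f_diff Bx).2) opprB addrA subrK.
have d_le : `|gateaux f x (w - x) - gateaux f x (xi - x)| <=
    2 * (2 * `|r| + `|f w - y|).
  have := tcc_gateaux_le Bx Bw; have := tcc_gateaux_le Bx Bxi.
  rewrite f_xi -(opprB (f x)) normrN -/r.
  have := ler_normB (gateaux f x (w - x)) (gateaux f x (xi - x)).
  have := ler_normB (f w - y) (f x - y); rewrite opprB addrA subrK -/r; lra.
apply: (le_trans (ler_pM _ _ t_le (norm_inner_le _ _))) => //.
have := ler_wpM2r (normr_ge0 r) d_le.
have lmax : 0 <= 2 * lambda_max by apply: le_trans t_le.
by move=> /(ler_wpM2l lmax); lra.
Qed.

End solution.
End step.
End tangential_cone.

(** * Strong convergence of cyclic sequences *)

Lemma exists_argmin (R : realType) (s : nat -> R) (k j : nat) : (k <= j)%N ->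
  exists2 l, (k <= l <= j)%N & forall m, (k <= m <= j)%N -> s l <= s m.
Proof.
move=> /subnKC <-; elim: (j - k)%N => [|n [l l_itv l_min]].
  by exists k; rewrite ?addn0 ?leqnn// => m; rewrite -eqn_leq => /eqP <-.
have /andP[kl ln] := l_itv.
have min_S m : (k <= m <= k + n.+1)%N -> m = (k + n.+1)%N \/ s l <= s m.
  move=> /andP[km]; rewrite addnS leq_eqVlt ltnS => /orP[/eqP->|mn].
    by left.
  by right; apply: l_min; rewrite km.
have [le_l|/ltW le_n] := leP (s l) (s (k + n.+1)%N).
  by exists l => [|m /min_S[->|]//]; rewrite kl addnS leqW.
exists (k + n.+1)%N => [|m /min_S[->|]//]; first by rewrite leq_addr leqnn.
exact: le_trans.
Qed.

(** An abstract form of the argument for convergence of cyclic methods. The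
    squared errors [a] decrease, and [S m] measures by how much they decrease
    during the [N] steps following [m]. The increments may be large compared
    with this decrease, but tested against the error at [l] they are of the order
    of [S m * (S m + S l)]. *)
Section cyclic_sequence.
Context {R : realType} {X : hilbertType R}.
Variables (x : nat -> X) (xs : X) (N : nat) (D : R).
Let a m := `|x m - xs| ^+ 2.
Let S m := Num.sqrt (a m - a (m + N)%N).
Hypothesis D_ge0 : 0 <= D.
Hypothesis a_step : forall m, a m.+1 <= a m.
Hypothesis increment_le : forall m l,
  `|inner (x m.+1 - x m) (x l - xs)| <= D * (S m * (S m + S l)).

Let b m := \sum_(p < N) a (m + p)%N.

Lemma error_homo k j : (k <= j)%N -> a j <= a k.
Proof.
move=> /subnKC <-; elim: (j - k)%N => [|n IHn]; first by rewrite addn0.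
by rewrite addnS (le_trans (a_step _)).
Qed.

(** Shifting the window of [b] by one step loses [a m] and gains [a (m + N)]. *)
Lemma sqr_drop m : S m ^+ 2 = b m - b m.+1.
Proof.
rewrite sqr_sqrtr ?subr_ge0 ?error_homo ?leq_addr//.
have last_term : \sum_(p < N.+1) a (m + p)%N = b m + a (m + N)%N.
  by rewrite big_ord_recr.
have first_term : \sum_(p < N.+1) a (m + p)%N = a m + b m.+1.
  rewrite big_ord_recl addn0; congr (_ + _).
  by apply: eq_bigr => p _; rewrite /= addSnnS.
by move: last_term; rewrite first_term; lra.
Qed.

Lemma window_homo k j : (k <= j)%N -> b j <= b k.
Proof. by move=> kj; apply: ler_sum => p _; rewrite error_homo ?leq_add2r. Qed.

(** Where [S l <= S m], the tested increment at [m] is of the order of [S m ^+ 2],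
    which by [sqr_drop] is a decrease of [b]. *)
Lemma inner_increments_le k j l : (k <= j)%N ->
  (forall m, (k <= m <= j)%N -> S l <= S m) ->
  `|inner (x j - x k) (x l - xs)| <= 2 * D * (b k - b j).
Proof.
move=> /subnKC <-; elim: (j - k)%N => [|n IHn] l_min.
  by rewrite addn0 !subrr inner0l normr0 mulr0.
have l_le m : (k <= m <= k + n)%N -> S l <= S m.
  by move=> /andP[km mn]; apply: l_min; rewrite km addnS leqW.
have S_l : S l <= S (k + n)%N by apply: l_le; rewrite leq_addr leqnn.
have -> : x (k + n.+1)%N - x k =
    (x (k + n).+1 - x (k + n)%N) + (x (k + n)%N - x k).
  by rewrite addnS addrA subrK.
rewrite innerDl addnS; apply: (le_trans (ler_normD _ _)).
have := IHn l_le; have := increment_le (k + n) l.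
have := congr1 ( *%R D) (sqr_drop (k + n)).
have S_ge0 : 0 <= S (k + n)%N by exact: sqrtr_ge0.
have := ler_wpM2l D_ge0 (ler_wpM2l S_ge0 (lerD (lexx (S (k + n)%N)) S_l)).
by rewrite expr2; lra.
Qed.

(** Both [x k] and [x j] are compared with the iterate [x l] in between at which
    [S] is smallest, via
    [`|u - w|^2 = `|u|^2 - `|w|^2 + 2 * inner (w - u) w]. *)
Lemma sqr_dist_le k j : (k <= j)%N ->
  `|x k - x j| ^+ 2 <= 2 * ((a k + 8 * D * b k) - (a j + 8 * D * b j)).
Proof.
move=> kj; have [l /andP[kl lj] l_min] := exists_argmin S kj.
have polar u v : `|u - v| ^+ 2 =
    `|u - xs| ^+ 2 - `|v - xs| ^+ 2 + 2 * inner (v - u) (v - xs).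
  have -> : u - v = (u - xs) - (v - xs) by rewrite opprB addrA subrK.
  have -> : v - u = (v - xs) - (u - xs) by rewrite opprB addrA subrK.
  move: (u - xs) (v - xs) => p q.
  by rewrite sqr_normB innerDl innerNl inner_norm; lra.
have kl_le : `|inner (x l - x k) (x l - xs)| <= 2 * D * (b k - b l).
  apply: inner_increments_le => // m /andP[km ml].
  by apply: l_min; rewrite km (leq_trans ml).
have lj_le : `|inner (x j - x l) (x l - xs)| <= 2 * D * (b l - b j).
  apply: inner_increments_le => // m /andP[lm mj].
  by apply: l_min; rewrite mj andbT (leq_trans kl).
have dist_kl : `|x k - x l| ^+ 2 <= a k - a l + 4 * D * (b k - b l).
  by rewrite polar /a; have := ler_norm (inner (x l - x k) (x l - xs)); lra.
have dist_jl : `|x j - x l| ^+ 2 <= a j - a l + 4 * D * (b l - b j).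
  rewrite polar /a -(opprB (x j) (x l)) innerNl.
  by have := ler_norm (- inner (x j - x l) (x l - xs)); rewrite normrN; lra.
have -> : x k - x j = (x k - x l) - (x j - x l) by rewrite opprB addrA subrK.
move: (x k - x l) (x j - x l) dist_kl dist_jl => p q dist_kl dist_jl.
have := sqr_ge0 `|p + q|; rewrite sqr_normB sqr_normD.
have := error_homo lj.
have := ler_wpM2l D_ge0 (window_homo kl).
have := ler_wpM2l D_ge0 (window_homo lj).
lra.
Qed.

Lemma cyclic_sequence_cvg : cvgn x.
Proof.
pose Phi m := a m + 8 * D * b m.
have D8 : 0 <= 8 * D by rewrite mulr_ge0.
have Phi_dec k j : (k <= j)%N -> Phi j <= Phi k.
  by move=> kj; rewrite lerD ?error_homo// ler_wpM2l ?window_homo.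
have Phi_cvg : cvgn Phi.
  apply: nonincreasing_is_cvgn => //; exists 0 => _ [m _ <-].
  by rewrite addr_ge0 ?sqr_ge0// mulr_ge0// sumr_ge0// => p _; exact: sqr_ge0.
apply: (@cvgn_sqr_dist_le _ _ _ (fun k => 2 * (Phi k - limn Phi))).
  rewrite -(mulr0 2) -(subrr (limn Phi)).
  by apply: cvgMr; apply: cvgB => //; exact: cvg_cst.
move=> k j kj; apply: (le_trans (sqr_dist_le kj)).
by rewrite ler_wpM2l// lerD2l lerN2; exact: nonincreasing_cvgn_ge.
Qed.

Lemma cyclic_sequence_drop0 : S @ \oo --> (0 : R).
Proof.
have b_cvg : cvgn b.
  apply: nonincreasing_is_cvgn => [k j|]; first exact: window_homo.
  by exists 0 => _ [m _ <-]; rewrite sumr_ge0// => p _; exact: sqr_ge0.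
rewrite -sqrtr0; have -> : S = Num.sqrt \o (fun m => b m - b m.+1).
  by apply/funext => m; rewrite /= -sqr_drop sqrtr_sqr ger0_norm ?sqrtr_ge0.
apply: continuous_cvg; first exact: sqrt_continuous.
rewrite -(subrr (limn b)); apply: cvgB => //.
by rewrite (cvg_shiftS b).
Qed.

End cyclic_sequence.

(** * Convergence of the iteration *)

Lemma cyc_surj (N : nat) (N_gt0 : (0 < N)%N) (l : nat) (i : 'I_N) :
  exists2 p, (p < N)%N & cyc N_gt0 (l + p) = i.
Proof.
exists ((i + (N - l %% N)) %% N)%N; first by rewrite ltn_pmod.
apply: val_inj; rewrite /= modnDmr -modnDml addnCA subnKC; last first.
  by rewrite ltnW// ltn_pmod.
by rewrite modnDr modn_small.
Qed.

Theorem theoremA1 (R : realType) (X Y : hilbertType R)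
  (N : nat) (N_gt0 : (0 < N)%N)
  (Dom : 'I_N -> set X) (F : 'I_N -> X -> Y) (y : 'I_N -> Y)
  (x0 : X) (C rho eta lambda_max : R) (theta : nat -> R) (x : nat -> X)
  (* A1 *)
  (F_cont : forall i, {within Dom i, continuous (F i)})
  (D_interior : (\bigcap_i Dom i)° !=set0)
  (x0_D : (\bigcap_i Dom i) x0)
  (C_gt0 : 0 < C) (rho_gt0 : 0 < rho)
  (ball_D : ball x0 rho `<=` \bigcap_i Dom i)
  (F_gateaux : forall i z, ball x0 rho z -> gateaux_differentiable (F i) z)
  (F'_le : forall i z, ball x0 rho z -> opnorm (gateaux (F i) z) <= C)
  (* A2 *)
  (eta_ge0 : 0 <= eta) (eta_lt1 : eta < 1)
  (tcc : forall i z z', ball x0 rho z -> ball x0 rho z' ->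
     `|F i z' - F i z - gateaux (F i) z (z' - z)| <= eta * `|F i z' - F i z|)
  (* A3 *)
  (sol : exists2 xstar, ball x0 (rho / 2) xstar & forall i, F i xstar = y i)
  (* PLWK iteration *)
  (lambda_max_gt : (1 - eta) * C ^- 2 < lambda_max)
  (theta_itv : forall k, 0 < theta k < 2)
  (x_plwk : plwk_sequence N_gt0 F y eta lambda_max theta x0 x)
  (inf_theta : 0 < inf (range theta))
  (sup_theta : sup (range theta) < 2) :
  exists xbar, [/\ ball x0 rho xbar, forall i, F i xbar = y i
                 & x @ \oo --> xbar].
Proof.
have [xs xs_half F_xs] := sol.
set B := ball x0 rho in ball_D F_gateaux F'_le tcc *.
have Bxs : B xs.
  by move: xs_half; rewrite /B -ball_normE/=; have := rho_gt0; lra.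
have [x_0 x_step] := x_plwk.
have eta1 : 0 < 1 - eta by rewrite subr_gt0.
have lmax_gt0 : 0 < lambda_max.
  by apply: lt_trans lambda_max_gt; rewrite divr_gt0// exprn_gt0.
pose i k := cyc N_gt0 k.
pose r k := `|F (i k) (x k) - y (i k)|.
pose a m := `|x m - xs| ^+ 2.
pose t0 := inf (range theta); pose t1 := sup (range theta).
have t0_le k : t0 <= theta k.
  apply: ge_inf; last by exists k.
  by exists 0 => _ [m _ <-]; have /andP[/ltW] := theta_itv m.
have le_t1 k : theta k <= t1.
  apply: ub_le_sup; last by exists k.
  by exists 2 => _ [m _ <-]; have /andP[_ /ltW] := theta_itv m.
pose c := t0 * (2 - t1) * ((1 - eta) ^+ 2 * C ^- 2).
have c_gt0 : 0 < c by rewrite !mulr_gt0 ?subr_gt0 ?invr_gt0 ?exprn_gt0.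
have descent k : B (x k) -> a k.+1 <= a k - c * r k ^+ 2.
  move=> Bxk; rewrite /a (x_step k) -mulrA.
  apply: (le_trans (plwk_step_descent (F_gateaux _) (F'_le _) eta_lt1 C_gt0
    (tcc _) Bxk lambda_max_gt Bxs (F_xs _) (theta_itv k))).
  rewrite lerD2l lerN2 ler_wpM2r ?sqr_ge0// ler_wpM2r//.
    by rewrite mulr_ge0 ?invr_ge0 ?sqr_ge0.
  rewrite ler_pM ?t0_le ?(ltW inf_theta)// ?subr_ge0 ?(ltW sup_theta)//.
  by rewrite lerD2l lerN2.
(* The solution lies in the ball of half the radius, so monotonicity of the
   distance to it keeps the iterates in the full ball. *)
have xs_dist k : B (x k) /\ `|x k - xs| <= `|x0 - xs|.
  elim: k => [|k [Bxk IHk]]; first by rewrite x_0; split=> //; exact: ballxx.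
  have le_xs : `|x k.+1 - xs| <= `|x0 - xs|.
    apply: le_trans IHk; rewrite -(@ler_pXn2r _ 2) ?nnegrE//.
    apply: (le_trans (descent k Bxk)).
    by rewrite lerBlDr lerDl mulr_ge0 ?(ltW c_gt0) ?sqr_ge0.
  split=> //; move: xs_half; rewrite /B -!ball_normE/=.
  have := ler_normD (x0 - xs) (xs - x k.+1).
  by rewrite addrA subrK (distrC xs); lra.
have Bx k : B (x k) by have [] := xs_dist k.
have a_step m : a m.+1 <= a m.
  apply: (le_trans (descent m (Bx m))).
  by rewrite lerBlDr lerDl mulr_ge0 ?(ltW c_gt0) ?sqr_ge0.
(* Each of the [N] residuals met from step [m] on contributes to the decrease of
   [a] over that cycle, which is [S m ^+ 2]. *)
pose S m := Num.sqrt (a m - a (m + N)%N).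
pose kappa := Num.sqrt c^-1.
have r_le m p : (p < N)%N -> r (m + p)%N <= kappa * S m.
  move=> pN; rewrite -sqrtrM ?invr_ge0 ?(ltW c_gt0)//.
  rewrite -[r _]ger0_norm ?normr_ge0// -sqrtr_sqr ler_wsqrtr// mulrC.
  rewrite ler_pdivlMr// mulrC.
  have := descent _ (Bx (m + p)%N).
  have : a (m + p)%N <= a m by apply: error_homo (leq_addr _ _).
  have : a (m + N)%N <= a (m + p).+1.
    by apply: error_homo => //; rewrite -addnS leq_add2l.
  lra.
have kappa_ge0 : 0 <= kappa by exact: sqrtr_ge0.
have S_ge0 m : 0 <= S m by exact: sqrtr_ge0.
pose sigma := 2 * lambda_max * C * kappa.
have sigma_ge0 : 0 <= sigma by rewrite !mulr_ge0 ?(ltW lmax_gt0) ?(ltW C_gt0).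
have step_le m p : (p <= N)%N -> `|x (m + p)%N - x m| <= p%:R * sigma * S m.
  elim: p => [_|p IHp pN]; first by rewrite addn0 subrr normr0 !mul0r.
  have -> : x (m + p.+1)%N - x m =
      (x (m + p).+1 - x (m + p)%N) + (x (m + p)%N - x m).
    by rewrite addnS addrA subrK.
  apply: (le_trans (ler_normD _ _)).
  have := IHp (ltnW pN).
  rewrite (x_step (m + p)%N) addrAC subrr add0r normrN -(mulrA (theta _)).
  have := norm_plwk_step_le (F_gateaux (i (m + p)%N)) (F'_le _) eta_lt1 C_gt0
    (y (i (m + p)%N)) (Bx (m + p)%N) lambda_max_gt (theta_itv (m + p)%N).
  have lC : 0 <= 2 * lambda_max * C.
    by rewrite !mulr_ge0 ?(ltW lmax_gt0) ?(ltW C_gt0).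
  have := ler_wpM2l lC (r_le m p pN).
  by rewrite -(natr1 p) /sigma /r /i; lra.
pose K := kappa + C / (1 - eta) * (N%:R * sigma).
have L_ge0 : 0 <= C / (1 - eta) by rewrite divr_ge0 ?ltW.
have K_ge0 : 0 <= K.
  by apply: addr_ge0 => //; apply: mulr_ge0 => //; exact: mulr_ge0.
(* Equation [j] is treated within [N] steps after [l], and until then the iterate
   moves little; the cone condition turns this into a bound on its residual. *)
have residual_le j l : `|F j (x l) - y j| <= K * S l.
  have [p pN <-] := cyc_surj N_gt0 l j.
  rewrite -/(i (l + p)%N).
  have -> : F (i (l + p)%N) (x l) - y (i (l + p)%N) =
      (F (i (l + p)%N) (x (l + p)%N) - y (i (l + p)%N))
      - (F (i (l + p)%N) (x (l + p)%N) - F (i (l + p)%N) (x l)).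
    by rewrite opprB [RHS]addrC addrA subrK.
  apply: (le_trans (ler_normB _ _)); rewrite /K mulrDl -(mulrA (C / (1 - eta))).
  apply: lerD; first exact: r_le.
  apply: (le_trans
    (tcc_lipschitz (F_gateaux _) (F'_le _) eta_lt1 (tcc _) _ _)) => //.
  rewrite ler_wpM2l//.
  apply: (le_trans (step_le l p (ltnW pN))).
  by rewrite !ler_wpM2r// ler_nat ltnW.
have D_ge0 : 0 <= 4 * lambda_max * kappa * (K + 2 * kappa).
  have K2_ge0 : 0 <= K + 2 * kappa by rewrite addr_ge0 ?mulr_ge0.
  have l4_ge0 : 0 <= 4 * lambda_max by rewrite mulr_ge0 ?ltW.
  by do 2?apply: mulr_ge0.
have increment_le m l : `|inner (x m.+1 - x m) (x l - xs)| <=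
    4 * lambda_max * kappa * (K + 2 * kappa) * (S m * (S m + S l)).
  have /= := inner_plwk_step_le (F_gateaux _) eta_lt1
    (tcc _) (Bx m) lambda_max_gt Bxs (F_xs (i m)) (theta_itv m) (Bx l).
  rewrite (x_step m) addrAC subrr add0r innerNl normrN -(mulrA (theta m)).
  move=> /le_trans; apply.
  have r_m : r m <= kappa * S m by have := r_le m 0%N N_gt0; rewrite addn0.
  have m_le := residual_le (i m) l.
  have sum_le : 2 * r m + `|F (i m) (x l) - y (i m)| <=
      (K + 2 * kappa) * (S m + S l).
    have := mulr_ge0 K_ge0 (S_ge0 m); have := mulr_ge0 kappa_ge0 (S_ge0 l).
    lra.
  have r_ge0 : 0 <= r m by exact: normr_ge0.
  have s_ge0 : 0 <= 2 * r m + `|F (i m) (x l) - y (i m)|.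
    by rewrite addr_ge0 ?mulr_ge0.
  have l4_ge0 : 0 <= 4 * lambda_max by rewrite mulr_ge0 ?ltW.
  have := ler_wpM2l l4_ge0 (ler_pM r_ge0 s_ge0 r_m sum_le).
  by rewrite /r; lra.
have x_cvg : cvgn x by exact: cyclic_sequence_cvg D_ge0 a_step increment_le.
have S0 : S @ \oo --> (0 : R) by exact: cyclic_sequence_drop0 a_step.
pose xbar := limn x.
have Bxbar : B xbar.
  have : `|xbar - xs| <= `|x0 - xs|.
    have dist_cvg : `|x k - xs| @[k --> \oo] --> `|xbar - xs|.
      by apply: cvg_norm; apply: cvgB => //; exact: cvg_cst.
    rewrite -(cvg_lim _ dist_cvg)//; apply: limr_le; first exact: cvgP dist_cvg.
    by near=> k; have [] := xs_dist k.
  move: xs_half; rewrite /B -!ball_normE/=.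
  have := ler_normD (x0 - xs) (xs - xbar).
  by rewrite addrA subrK (distrC xs); lra.
exists xbar; split=> // j.
apply/eqP; rewrite -subr_eq0 -normr_le0.
pose u l := C / (1 - eta) * `|xbar - x l| + K * S l.
have dist0 : `|xbar - x l| @[l --> \oo] --> (0 : R).
  have : `|xbar - x l| @[l --> \oo] --> `|xbar - xbar|.
    by apply: cvg_norm; apply: cvgB => //; exact: cvg_cst.
  by rewrite subrr normr0.
have u0 : u @ \oo --> (0 : R).
  have : u @ \oo --> C / (1 - eta) * 0 + K * 0.
    by apply: cvgD; apply: cvgMr.
  by rewrite !mulr0 addr0.
rewrite -(cvg_lim _ u0)//; apply: limr_ge; first exact: cvgP u0.
near=> l; rewrite -(subrK (F j (x l)) (F j xbar)) -addrA.
apply: (le_trans (ler_normD _ _)); apply: lerD => //.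
exact: (tcc_lipschitz (F_gateaux _) (F'_le _) eta_lt1 (tcc _)).
Unshelve. all: by end_near. Qed.
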